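(* Let $G$ be a finite group, $Y\subset G$ a non-empty subset, and $f:G\to\mathbb{C}$ a function. For every $\rho\in\widehat{G}$ put $$\partial_\rho(Y):=\sqrt{\frac{\dim\rho}{(\#Y)^2\,\#G}\sum_{x,y\in Y}\chi_\rho(x^{-1}y)}.$$ Then for every $\rho\in\widehat{G}$, $$|I(f_\rho)-I_Y(f_\rho)|\le \|f_\rho\|\,\partial_\rho(Y).$$ Moreover, for the trivial representation $\rho=1_G$ one has $|I(f_{1_G})-I_Y(f_{1_G})|=0$.
   Context: $\mathbb{C}^G$ is the space of functions $G\to\mathbb{C}$, with inner product $\langle f,g\rangle=\sum_{x\in G}f(x)\overline{g(x)}$ and norm $\|f\|=\sqrt{\langle f,f\rangle}$. For $f\in\mathbb{C}^G$, $I(f)=\frac1{\#G}\sum_{x\in G}f(x)$ and $I_Y(f)=\frac1{\#Y}\sum_{x\in Y}f(x)$. $\widehat{G}$ is the set of isomorphism classes of irreducible complex representations of $G$; $\chi_\rho$ and $\dim\rho$ denote the character and dimension of $\rho\in\widehat G$; $1_G$ is the trivial representation. $\mathbb{C}^G$ is a left $G$-module via $(gf)(x)=f(g^{-1}x)$, and decomposes orthogonally as $\mathbb{C}^G=\bigoplus_{\rho\in\widehat{G}}V_\rho$ with $V_\rho$ the $\rho$-isotypic component. Accordingly $f=\sum_\rho f_\rho$ with $f_\rho\in V_\rho$, and $f_\rho$ is the $\rho$-component of $f$. The quantity under the square root defining $\partial_\rho(Y)$ is a non-negative real number, and $\partial_\rho(Y)$ is its non-negative square root. *)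

(* Defs.v *)
From mathcomp Require Import all_boot all_order all_algebra all_fingroup.
From mathcomp Require Import mxrepresentation.
From mathcomp Require Import complex.
From mathcomp Require Import boolp reals.

Set Implicit Arguments.
Unset Strict Implicit.
Unset Printing Implicit Defensive.

Import Order.TTheory GRing.Theory Num.Theory.

Local Open Scope ring_scope.

(* The space C^G; [R[i]^o] makes it a vector space over R[i]. *)
Notation funG R gT := {ffun gT -> R[i]^o}.

Section Defs.
Variables (R : realType) (gT : finGroupType).
Local Notation C := R[i].
Local Notation CG := (funG R gT).

(* One element for each isomorphism class of irreducible complex
   representations of the whole group; [irr_repr rho] is a representative of
   the class [rho] (see [rsim_irr_comp_pchar]). *)
Definition Ghat : irrType C [set: gT] :=
  DecSocleType (regular_repr C [set: gT]).

Definition dimrep (rho : Ghat) : nat := irr_degree rho.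

Definition chi (rho : Ghat) (g : gT) : C := \tr (irr_repr rho g).

Definition dot_CG (f g : CG) : C := \sum_(x : gT) (f x : C) * (g x)^*.

(* [sqrtC] is the non-negative square root on non-negative reals. *)
Definition norm_CG (f : CG) : C := sqrtC (dot_CG f f).

Definition mean_on (Y : {set gT}) (f : CG) : C :=
  #|Y|%:R^-1 * \sum_(x in Y) (f x : C).

Definition mean (f : CG) : C := #|gT|%:R^-1 * \sum_(x : gT) (f x : C).

Definition translate (g : gT) (f : CG) : CG :=
  [ffun x => f (g^-1 * x)%g].

(* U is a left G-submodule of C^G isomorphic to rho. Left modules are obtained
   by letting the matrices of rho act on column vectors, so no dual enters. *)
Definition copy_of (rho : Ghat) (U : {vspace CG}) : Prop :=
  exists phi : 'Hom('cV[C]_(irr_degree rho), CG),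
    [/\ lker phi = 0%VS, limg phi = U &
        forall g v, phi (irr_repr rho g *m v) = translate g (phi v)].

Definition in_isotypic (rho : Ghat) (f : CG) : Prop :=
  exists s : seq {vspace CG},
    (forall U, U \in s -> copy_of rho U) /\ f \in (\sum_(U <- s) U)%VS.

Lemma isotypic_subproof (rho : Ghat) :
  exists V : {vspace CG}, forall f, f \in V <-> in_isotypic rho f.
Proof.
pose ok (s : seq {vspace CG}) := forall U, U \in s -> copy_of rho U.
pose P n := `[< exists2 s, ok s & \dim (\sum_(U <- s) U)%VS = n >].
have P0 : exists n, P n.
  by exists 0; apply/asboolP; exists [::] => //; rewrite big_nil dimv0.
have Pmax n : P n -> (n <= \dim {:CG})%N.
  by move=> /asboolP[s _ <-]; exact: dimvS (subvf _).
case: (ex_maxnP P0 Pmax) => n /asboolP[s oks dims] maxn.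
exists (\sum_(U <- s) U)%VS => f; split=> [fs|[t [okt ft]]]; first by exists s.
have /eqP-> : (\sum_(U <- s) U == \sum_(U <- s ++ t) U)%VS.
  rewrite eqEdim big_cat addvSl /= dims maxn //; apply/asboolP.
  exists (s ++ t); last by rewrite big_cat.
  by move=> U; rewrite mem_cat => /orP[/oks|/okt].
by rewrite big_cat; exact: subvP (addvSr _ _) _ ft.
Qed.

(* The rho-isotypic component of C^G: the sum of all the submodules isomorphic
   to rho. *)
Definition isotypic (rho : Ghat) : {vspace CG} :=
  projT1 (cid (isotypic_subproof rho)).

Lemma isotypicP (rho : Ghat) (f : CG) :
  f \in isotypic rho <-> in_isotypic rho f.
Proof. exact: (projT2 (cid (isotypic_subproof rho))). Qed.

(* The rho-component of f: projection onto the summand [isotypic rho] along the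
   others; C^G is the direct sum of the isotypic components. *)
Definition component (f : CG) (rho : Ghat) : CG :=
  sumv_pi (\sum_(sigma : Ghat) isotypic sigma)%VS rho f.

Definition partial (rho : Ghat) (Y : {set gT}) : C :=
  sqrtC ((dimrep rho)%:R / (#|Y|%:R ^+ 2 * #|gT|%:R)
           * \sum_(x in Y) \sum_(y in Y) chi rho (x^-1 * y)%g).

End Defs.

Arguments component {R gT} f rho.
Arguments partial {R gT} rho Y.

(* Main.v *)
Require Import Defs.
From mathcomp Require Import all_boot all_order all_algebra all_fingroup.
From mathcomp Require Import pgroup mxrepresentation sesquilinear spectral
  complex reals.

Set Implicit Arguments.
Unset Strict Implicit.
Unset Printing Implicit Defensive.

Import Order.TTheory GRing.Theory Num.Theory.

Local Open Scope ring_scope.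

(** The map sending [f] to its mean over [Y] is a linear functional. On the
    [rho]-isotypic component it is the inner product with a vector [K] of that
    same component, and the norm of [K] is exactly the quantity bounding the
    error.

    A copy of [rho] inside C^G consists of functions x |-> l (rho(x^-1) v), so
    every function of the isotypic component is a matrix coefficient
    x |-> tr (rho(x^-1) A) ([isotypic_matrix_coef]). Schur orthogonality says
    that such a function [h] is reproduced by the character,
      sum_z h(z) chi(y^-1 z) = (#G / dim rho) h(y)
    ([reproducing_chi]). Since chi(g^-1) is the conjugate of chi(g)
    ([mxtrace_reprV]), averaging over [y] in [Y] gives I_Y(h) = <h, K> for
      K(z) = dim rho / (#Y #G) sum_(y in Y) chi(z^-1 y)
    ([mean_on_dot]). [K] is itself a matrix coefficient, so
    <K, K> = I_Y(K), which expands to the expression under the square root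
    ([dot_mean_kernel]); in particular that expression is non-negative.

    For [rho] nontrivial, sum_x rho(x) = 0, hence I(h) = 0 and the bound is the
    Cauchy-Schwarz inequality for <h, K>. For [rho] trivial, [h] is constant and
    both means agree. *)

(** * Complex representations of a finite group *)

Section Representations.

Variables (C : numClosedFieldType) (gT : finGroupType) (G : {group gT}).

Lemma num_pchar'_group : ([pchar C]^'.-group G)%g.
Proof. by apply/pgroupP=> p _; rewrite inE /= pchar_num. Qed.

Variables (n : nat) (rG : mx_representation C G n).

Local Notation "A ^t*" := ((map_mx Num.conj A)^T).

Lemma mxdnorm_ge0 (v : 'rV[C]_n) : 0 <= (v *m v^t*) 0 0.
Proof.
by rewrite mxE sumr_ge0 // => i _; rewrite !mxE mul_conjC_ge0.
Qed.

Lemma mxdnorm_eq0 (v : 'rV[C]_n) : (v *m v^t*) 0 0 = 0 -> v = 0.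
Proof.
rewrite mxE => /psumr_eq0P v0; apply/rowP=> i; rewrite mxE.
apply/eqP; rewrite -mul_conjC_eq0; apply/eqP.
have := v0 _ i isT; rewrite !mxE; apply=> j _.
by rewrite !mxE mul_conjC_ge0.
Qed.

(** Weyl's unitary trick: the sum [H] of the rho(g) rho(g)^* is a positive
    definite Hermitian form preserved by [rho], so rho(x)^* is conjugate to
    rho(x^-1) by [H]; taking traces gives the claim. *)
Lemma mxtrace_reprV x : x \in G -> \tr (rG x^-1%g) = (\tr (rG x))^*.
Proof.
move=> Gx; pose H := \sum_(g in G) rG g *m (rG g)^t*.
have HJ : rG x *m H *m (rG x)^t* = H.
  rewrite mulmx_sumr mulmx_suml [RHS](reindex_inj (mulgI x)) /=.
  apply: eq_big => g; first by rewrite groupMl.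
  by move=> Gg; rewrite repr_mxM // map_mxM trmx_mul !mulmxA.
(* v H v^* is the sum over g of the squared norms of v rho(g). *)
have Hunit : H \in unitmx.
  rewrite -row_free_unit -kermx_eq0; apply/rowV0P => v /sub_kermxP vH0.
  have: (v *m H *m v^t*) 0 0 = 0 by rewrite vH0 mul0mx mxE.
  rewrite mulmx_sumr mulmx_suml summxE => /psumr_eq0P v0.
  (* The summand of the identity of G is the squared norm of v. *)
  rewrite -[v]mulmx1 -(repr_mx1 rG); apply: mxdnorm_eq0.
  rewrite map_mxM trmx_mul mulmxA -[v *m _ *m _]mulmxA; apply: v0 => // g Gg.
  by rewrite !mulmxA -mulmxA -trmx_mul -map_mxM mxdnorm_ge0.
have -> : (\tr (rG x))^* = \tr ((rG x)^t*) by rewrite mxtrace_tr trace_map_mx.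
have -> : (rG x)^t* = invmx H *m rG x^-1%g *m H.
  by rewrite -{2}HJ !mulmxA repr_mxKV // mulVmx // mul1mx.
by rewrite -mulmxA mxtrace_mulC mulmxK.
Qed.

Hypothesis absG : mx_absolutely_irreducible rG.

(** The sum commutes with [rho], hence is scalar by Schur's lemma; its trace
    gives the scalar. *)
Lemma mx_sum_conj (M : 'M[C]_n) :
  \sum_(z in G) rG z *m M *m rG z^-1%g = (#|G|%:R / n%:R * \tr M)%:M.
Proof.
set S := \sum_(z in G) _.
have /is_scalar_mxP[c Sc] : is_scalar_mx S.
  apply: (mx_abs_irr_cent_scalar absG); apply/centgmxP=> x Gx.
  rewrite mulmx_sumr mulmx_suml (reindex_inj (mulgI x)) /=.
  apply: eq_big => g; first by rewrite groupMl.
  move=> Gg; rewrite (groupMl _ Gx) in Gg.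
  by rewrite invMg !repr_mxM ?groupV // !mulmxA repr_mxKV.
have n_neq0 : n%:R != 0 :> C.
  by rewrite pnatr_eq0 -lt0n; case/mx_abs_irrP: absG.
rewrite Sc; congr (_%:M); apply: (mulIf n_neq0).
rewrite mulr_natr -mxtrace_scalar -Sc /S raddf_sum /=.
rewrite (eq_bigr (fun=> \tr M)) => [|z Gz]; last first.
  by rewrite mxtrace_mulC mulmxA -repr_mxM ?groupV // mulVg repr_mx1 mul1mx.
by rewrite sumr_const -[LHS]mulr_natl mulrAC divfK.
Qed.

(** Fourier inversion at a single representation: a matrix is recovered from its
    matrix coefficients. *)
Lemma mx_fourier_inversion (A : 'M[C]_n) :
  \sum_(z in G) \tr (rG z^-1%g *m A) *: rG z = (#|G|%:R / n%:R) *: A.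
Proof.
(* Schur orthogonality is [mx_sum_conj] at an elementary matrix. *)
have orth i j k l : \sum_(z in G) rG z i j * rG z^-1%g k l
    = #|G|%:R / n%:R * ((j == k) && (i == l))%:R.
  transitivity ((\sum_(z in G) rG z *m delta_mx j k *m rG z^-1%g) i l).
    rewrite summxE; apply: eq_bigr => z _.
    rewrite mxE (bigD1 k) //= big1 => [|m /negPf km].
      rewrite addr0 mxE (bigD1 j) //= big1 => [|m /negPf jm].
        by rewrite addr0 mxE !eqxx mulr1.
      by rewrite mxE jm mulr0.
    rewrite mxE big1 ?mul0r // => p _.
    by rewrite mxE km andbF mulr0.
  rewrite mx_sum_conj mxE.
  have -> : \tr (delta_mx j k : 'M[C]_n) = (j == k)%:R.
    rewrite /mxtrace (bigD1 j) //= big1 ?addr0 => [|m /negPf jm].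
      by rewrite mxE eqxx.
    by rewrite mxE jm.
  by rewrite -mulrnAr -mulrnA mulnb.
apply/matrixP=> k l; rewrite summxE.
transitivity (\sum_i \sum_j \sum_(z in G)
    A j i * (rG z k l * rG z^-1%g i j)).
  under [RHS]eq_bigr do rewrite exchange_big /=.
  rewrite exchange_big /=; apply: eq_bigr => z _.
  rewrite mxE /mxtrace mulr_suml; apply: eq_bigr => i _.
  rewrite mxE mulr_suml; apply: eq_bigr => j _.
  by rewrite [RHS]mulrA -[RHS]mulrC !mulrA [_ * A j i]mulrC mulrAC.
under eq_bigr do under eq_bigr do rewrite -mulr_sumr orth.
rewrite (bigD1 l) //= [X in _ + X]big1 ?addr0 => [|i /negPf il]; last first.
  by rewrite big1 // => j _; rewrite eq_sym il !mulr0.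
rewrite (bigD1 k) //= big1 ?addr0 => [|j /negPf jk]; last first.
  by rewrite [k == j]eq_sym jk andbF !mulr0.
by rewrite !eqxx mulr1 mxE mulrC.
Qed.

(** Multiply Fourier inversion by rho(y^-1) and take the trace: up to a
    constant, convolution with the character fixes the matrix coefficients. *)
Lemma reproducing_chi (A : 'M[C]_n) y : y \in G ->
  \sum_(z in G) \tr (rG z^-1%g *m A) * \tr (rG (y^-1 * z)%g)
    = #|G|%:R / n%:R * \tr (rG y^-1%g *m A).
Proof.
move=> Gy; rewrite -mxtraceZ scalemxAr -mx_fourier_inversion mulmx_sumr.
rewrite raddf_sum; apply: eq_bigr => z Gz /=.
by rewrite repr_mxM ?groupV // -scalemxAr mxtraceZ.
Qed.

End Representations.

(** In the regular representation the sum of all group elements has invariant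
    rows, so it lies in the Wedderburn component of the trivial representation,
    which every other irreducible representation kills. *)
Lemma sum_irr_repr_eq0 (C : numClosedFieldType) (gT : finGroupType)
    (G : {group gT}) (sG : irrType C G) (i : sG) :
  i != [1 sG]%irr -> \sum_(x in G) irr_repr i x = 0.
Proof.
move=> neq_i1; pose S := \sum_(x in G) regular_repr C G x.
have opS : gring_op (irr_repr i) S = \sum_(x in G) irr_repr i x.
  by rewrite linear_sum; apply: eq_bigr => x Gx; rewrite /= gring_opG.
rewrite -opS; rewrite eq_sym in neq_i1.
apply: (irr_repr'_op0_pchar _ neq_i1); first exact: num_pchar'_group.
have gring_rowS : (gring_row S <= [1 sG]%irr)%MS.
  rewrite irr1_rfix; apply/rfix_mxP=> x Gx; rewrite -gring_row_mul.
  congr gring_row; rewrite mulmx_suml [RHS](reindex_inj (mulIg x)) /=.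
  by apply: eq_big => g; [rewrite groupMr | move=> Gg; rewrite repr_mxM].
rewrite genmxE mem_sub_gring gring_rowS andbT.
by rewrite linear_sum summx_sub // => x Gx; rewrite envelop_mx_id.
Qed.

(** * Isotypic components as spaces of matrix coefficients *)

Section Isotypic.

Variables (R : realType) (gT : finGroupType).
Local Notation C := R[i].
Local Notation CG := (funG R gT).
Local Notation G := [set: gT]%G.

Definition matrix_coef (rho : Ghat R gT) (A : 'M[C]_(irr_degree rho)) : CG :=
  [ffun x => \tr (irr_repr rho x^-1%g *m A)].

(** An equivariant embedding [phi] is determined by the functional
    w |-> phi w 1, because phi v x = phi (rho(x^-1) v) 1. *)
Lemma copy_of_matrix_coef rho U (f : CG) :
  copy_of rho U -> f \in U -> exists A, f = @matrix_coef rho A.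
Proof.
move=> [phi [_ <- phiJ]] /memv_imgP[v _ ->].
pose L : 'rV[C]_(irr_degree rho) := \row_i (phi (delta_mx i 0) 1%g : C).
(* The functional w |-> phi w 1 is w |-> L w, and tr (w L) = L w. *)
exists (v *m L); apply/ffunP=> x; rewrite ffunE.
have phi1 w : phi w 1%g = \tr (w *m L) :> C.
  rewrite mxtrace_mulC trace_mx11 mxE {1}[w]matrix_sum_delta linear_sum.
  rewrite sum_ffunE.
  apply: eq_bigr => i _; rewrite big_ord1 linearZ /= ffunE mxE.
  by rewrite [LHS]mulrC.
by rewrite mulmxA -phi1 phiJ ffunE invgK mulg1.
Qed.

Lemma isotypic_matrix_coef rho (f : CG) :
  f \in isotypic rho -> exists A, f = @matrix_coef rho A.
Proof.
move/isotypicP=> [s []]; elim: s f => [|U s IHs] f copies.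
  rewrite big_nil memv0 => /eqP->; exists 0.
  by apply/ffunP=> x; rewrite !ffunE mulmx0 mxtrace0.
rewrite big_cons => /memv_addP[u Uu [w sw ->]].
have [||A ->] := @copy_of_matrix_coef rho U u => //.
  by apply: copies; rewrite mem_head.
have [|B ->] := IHs w _ sw.
  by move=> V sV; apply: copies; rewrite inE sV orbT.
by exists (A + B); apply/ffunP=> x; rewrite !ffunE mulmxDr mxtraceD.
Qed.

(** The vector of the [rho]-isotypic component representing the mean over [Y],
    given through its coefficient matrix so that [mean_on_dot] applies to it. *)
Definition mean_kernel (Y : {set gT}) (rho : Ghat R gT) : CG :=
  @matrix_coef rho ((irr_degree rho)%:R / (#|Y|%:R * #|gT|%:R)
                    *: \sum_(y in Y) irr_repr rho y).

Lemma mean_kernelE Y rho z : mean_kernel Y rho z =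
  (irr_degree rho)%:R / (#|Y|%:R * #|gT|%:R)
    * \sum_(y in Y) chi rho (z^-1 * y)%g :> C.
Proof.
rewrite ffunE -scalemxAr mxtraceZ mulmx_sumr raddf_sum; congr (_ * _).
by apply: eq_bigr => y _; rewrite /chi repr_mxM ?inE.
Qed.

Lemma chiV (rho : Ghat R gT) x : chi rho x^-1%g = (chi rho x)^*.
Proof. by rewrite /chi mxtrace_reprV ?inE. Qed.

Lemma irr_degree_neq0 (rho : Ghat R gT) : (irr_degree rho)%:R != 0 :> C.
Proof. by rewrite pnatr_eq0 -lt0n irr_degree_gt0. Qed.

Lemma card_group_neq0 : #|gT|%:R != 0 :> C.
Proof. by rewrite -cardsT pnatr_eq0 -lt0n (cardG_gt0 G). Qed.

Lemma matrix_coef_chi rho (A : 'M[C]_(irr_degree rho)) y :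
  \sum_z matrix_coef A z * (chi rho (z^-1 * y)%g)^*
    = #|gT|%:R / (irr_degree rho)%:R * matrix_coef A y :> C.
Proof.
have absG : mx_absolutely_irreducible (irr_repr rho).
  exact: group_closure_closed_field (socle_irr rho).
rewrite [matrix_coef A y]ffunE -cardsT -(reproducing_chi absG) ?inE //.
apply: eq_big => z; first by rewrite inE.
by move=> _; rewrite ffunE -chiV invMg invgK.
Qed.

(** [matrix_coef_chi] averaged over the points of [Y]. *)
Lemma mean_on_dot Y rho (A : 'M[C]_(irr_degree rho)) :
  mean_on Y (matrix_coef A) = dot_CG (matrix_coef A) (mean_kernel Y rho).
Proof.
pose c : C := (irr_degree rho)%:R / (#|Y|%:R * #|gT|%:R).
transitivity (\sum_z \sum_(y in Y)
    c * (matrix_coef A z * (chi rho (z^-1 * y)%g)^*)); last first.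
  apply: eq_bigr => z _; rewrite mean_kernelE rmorphM rmorph_sum /=.
  rewrite fmorph_div rmorphM !rmorph_nat mulrCA !mulr_sumr.
  by apply: eq_bigr => y _; rewrite /c mulrCA.
rewrite exchange_big /mean_on mulr_sumr; apply: eq_bigr => y _.
rewrite -mulr_sumr matrix_coef_chi mulrA; congr (_ * _).
rewrite /c invfM [RHS]mulrC mulrA divfK ?irr_degree_neq0 //.
by rewrite mulrCA divff ?card_group_neq0 ?mulr1.
Qed.

(** The kernel is a matrix coefficient, so its square norm is its own mean over
    [Y]. *)
Lemma dot_mean_kernel Y rho :
  dot_CG (mean_kernel Y rho) (mean_kernel Y rho) =
  (dimrep rho)%:R / (#|Y|%:R ^+ 2 * #|gT|%:R)
    * \sum_(x in Y) \sum_(y in Y) chi rho (x^-1 * y)%g.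
Proof.
rewrite -mean_on_dot /mean_on.
under eq_bigr do rewrite -/(mean_kernel Y rho) mean_kernelE.
by rewrite -mulr_sumr mulrA [_^-1 * (_ / _)]mulrCA -invfM mulrA -expr2.
Qed.

Lemma dot_CG_CauchySchwarz (f g : CG) :
  `|dot_CG f g| <= norm_CG f * norm_CG g.
Proof.
pose row_of (h : CG) : 'rV[C]_#|gT| := \row_i (h (enum_val i) : C).
have dotE h k : dot_CG h k = dotmx (row_of h) (row_of k).
  rewrite dotmxE mxE /dot_CG big_enum_val; apply: eq_bigr => i _.
  by rewrite !mxE.
rewrite /norm_CG !dotE; exact: (CauchySchwarz_sqrt (@dotmx C #|gT|)).
Qed.

Lemma mean_matrix_coef_eq0 rho (A : 'M[C]_(irr_degree rho)) :
  rho != [1 (Ghat R gT)]%irr -> mean (matrix_coef A) = 0.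
Proof.
move=> rho1; have rho0 : \sum_x irr_repr rho x = 0.
  by apply: etrans (sum_irr_repr_eq0 rho1); apply: eq_bigl => x; rewrite inE.
have sumA : \sum_x (matrix_coef A x : C) = \tr ((\sum_x irr_repr rho x) *m A).
  rewrite mulmx_suml raddf_sum (reindex_inj invg_inj).
  by apply: eq_bigr => x _; rewrite ffunE invgK.
by rewrite /mean sumA rho0 mul0mx mxtrace0 mulr0.
Qed.

Lemma mean_sub_mean_on1 Y (A : 'M[C]_(irr_degree [1 (Ghat R gT)]%irr)) :
  Y != set0 -> mean (matrix_coef A) - mean_on Y (matrix_coef A) = 0.
Proof.
have trivA x : matrix_coef A x = \tr A :> C.
  by rewrite ffunE irr1_repr ?inE ?mul1mx.
move=> Y_neq0; rewrite /mean /mean_on.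
under eq_bigr do rewrite trivA.
under [X in _ - _ * X]eq_bigr do rewrite trivA.
rewrite !sumr_const -[\tr A *+ #|_|]mulr_natl -[\tr A *+ #|Y|]mulr_natl.
by rewrite !mulKf ?subrr ?card_group_neq0 // pnatr_eq0 cards_eq0.
Qed.

Lemma partial_mean_kernel Y rho : partial rho Y = norm_CG (mean_kernel Y rho).
Proof. by rewrite /norm_CG dot_mean_kernel. Qed.

End Isotypic.

Theorem theorem1 (R : realType) (gT : finGroupType) (Y : {set gT})
    (hY : Y != set0) (f : funG R gT) :
  (forall rho : Ghat R gT,
     `| mean (component f rho) - mean_on Y (component f rho) |
       <= norm_CG (component f rho) * partial rho Y)
  /\ `| mean (component f [1 (Ghat R gT)]%irr)
        - mean_on Y (component f [1 (Ghat R gT)]%irr) | = 0.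
Proof.
(* The projection onto a summand lands in that summand. *)
have coef rho : exists A, component f rho = @matrix_coef R gT rho A.
  exact: isotypic_matrix_coef (memv_sum_pi _ _ _).
split=> [rho|]; last first.
  by have [A ->] := coef [1 (Ghat R gT)]%irr; rewrite mean_sub_mean_on1 ?normr0.
have [A ->] := coef rho; rewrite partial_mean_kernel.
apply: le_trans (dot_CG_CauchySchwarz _ _); rewrite -mean_on_dot.
have [rho1 | /mean_matrix_coef_eq0->] := eqVneq rho [1 (Ghat R gT)]%irr.
  by move: A; rewrite rho1 => A; rewrite mean_sub_mean_on1 // normr0.
by rewrite sub0r normrN.
Qed.
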